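(* Let $L\ge 1$ and $k\ge 1$ be integers with $k$ dividing $L$, let $N$ be an $L$-bit integer ($2^{L-1}\le N<2^L$), let $a<N$ be a positive integer with $\gcd(a,N)=1$, let $r$ be the order of $a$ modulo $N$, and let $\epsilon>0$. Let $p,l_j,t_j$, the state $|\phi_{final}\rangle$, the measurement producing $m_1,\dots,m_k$, and the classical procedure CombineResults producing $m$ be as described in the context. Then, with probability at least $1-\epsilon$, the procedure CombineResults succeeds and its output $m$ (a $(2L+1+p)$-bit string, read as an integer) satisfies $$\left|\frac{m}{2^{2L+1+p}}-\frac{s_0}{r}\right|\le 2^{-(2L+1)}$$ for some $s_0\in\{0,1,\dots,r\}$.
   Context: Conventions: bit strings are identified with the binary integers they represent (most significant bit first). For a bit string $x=x_1x_2\cdots x_n$ and $1\le i\le j\le n$, $x_{[i,j]}=x_ix_{i+1}\cdots x_j$. For a real number $\omega$ with binary expansion of its fractional part $0.b_1b_2b_3\cdots$ (not ending in infinitely many 1's), $\omega_{\{i,j\}}=b_ib_{i+1}\cdots b_j$ for $1\le i\le j$. For two $t$-bit strings $x,y$, $d_t(x,y)=\min(|x-y|,2^t-|x-y|)$. For a positive integer $t$ and real $\omega$, $|\psi_{t,\omega}\rangle=QFT^{-1}\frac{1}{\sqrt{2^t}}\sum_{j=0}^{2^t-1}e^{2\pi i j\omega}|j\rangle$, where $QFT|j\rangle=\frac{1}{\sqrt{2^t}}\sum_{x=0}^{2^t-1}e^{2\pi i jx/2^t}|x\rangle$. For $s\in\{0,\dots,r-1\}$, $|u_s\rangle=\frac{1}{\sqrt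 r}\sum_{q=0}^{r-1}e^{-2\pi i sq/r}|a^q \bmod N\rangle$ (an $L$-qubit state); these are orthonormal. Parameters: $p=\lceil\log_2(2+\frac{1}{2\epsilon'})\rceil$ with $\epsilon'=\epsilon/k$; $l_j=(j-1)\frac{L}{k}+1$ for $j=1,\dots,k$ and $l_{k+1}=2L$; $t_j=l_{j+1}+2-l_j+p$ for $j=1,\dots,k$. Measured state: registers $A_1,\dots,A_k$ (register $A_j$ has $t_j$ qubits) and an $L$-qubit register $C$ are in the state $$|\phi_{final}\rangle=\frac{1}{\sqrt r}\sum_{s=0}^{r-1}\Big(\bigotimes_{j=1}^{k}|\psi_{t_j,2^{l_j-1}s/r}\rangle_{A_j}\Big)|u_s\rangle_C$$ (the state produced by the distributed order-finding circuit). In the computational basis, for $j=1,\dots,k-1$ the first $l_{j+1}+2-l_j$ qubits of $A_j$ are measured, giving an $(l_{j+1}+2-l_j)$-bit string $m_j$, and all $t_k$ qubits of $A_k$ are measured, giving a $t_k$-bit string $m_k$. CombineResults: set $m'_k=m_k$. For $u=k-1,k-2,\dots,1$: choose $c_u\in\{-1,0,1\}$ such that (the integer formed by the last two bits of $m_u$) $+c_u \equiv (m'_{u+1})_{[1,2]} \pmod 4$ (if no such $c_u$ exists the procedure fails); set $prefix_u=(m_u+c_u)\bmod 2^{l_{u+1}+2-l_u}$ written as an $(l_{u+1}+2-l_u)$-bit string, and $m'_u=prefix_u\circ (m'_{u+1})_{[3,\,2L+p+2-l_{u+1}]}$, where $\circ$ is concatenation. Output $m=m'_1$. *)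

(* Defs.v *)
From Stdlib Require Import Rdefinitions.
From mathcomp Require Import all_boot all_order all_algebra.
From mathcomp Require Import complex Rstruct.
From Stdlib Require Rtrigo_def Rtrigo1.

Set Implicit Arguments.
Unset Strict Implicit.
Unset Printing Implicit Defensive.

Import Order.TTheory GRing.Theory Num.Theory.
Local Open Scope ring_scope.

Definition Rpi : R := Rtrigo1.PI.

Definition cis (th : R) : R[i] := (Rtrigo_def.cos th +i* Rtrigo_def.sin th)%C.

Definition rC (x : R) : R[i] := (x +i* 0)%C.

Definition sqnorm (z : R[i]) : R := let: (a +i* b)%C := z in a ^+ 2 + b ^+ 2.

Definition invsqrt (n : nat) : R := (Num.sqrt (n%:R : R))^-1.

(* Matrix entry <x| QFT^{-1} |j> on t qubits, where
   QFT|j> = 2^{-t/2} sum_x e^{2 pi i j x / 2^t} |x>; its inverse (= adjoint)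
   has entries 2^{-t/2} e^{-2 pi i j x / 2^t}. *)
Definition qft_inv (t x j : nat) : R[i] :=
  rC (invsqrt (expn 2 t)) * cis (- (2%:R * Rpi * (j * x)%:R / (expn 2 t)%:R)).

(* amplitude of |j> in 2^{-t/2} sum_j e^{2 pi i j omega} |j> *)
Definition pre_psi (t : nat) (omega : R) (j : nat) : R[i] :=
  rC (invsqrt (expn 2 t)) * cis (2%:R * Rpi * j%:R * omega).

Definition psi (t : nat) (omega : R) (x : nat) : R[i] :=
  \sum_(j < expn 2 t) qft_inv t x j * pre_psi t omega j.

Definition u_amp (a N r s c : nat) : R[i] :=
  rC (invsqrt r) *
  \sum_(q < r) (if (modn (expn a q) N == c)%N
                then cis (- (2%:R * Rpi * (s * q)%:R / r%:R)) else 0).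

Definition lpar (L k j : nat) : nat :=
  if j == k.+1 then (2 * L)%N else (divn ((j - 1) * L) k + 1)%N.

(* number of measured qubits of A_j for j < k: l_{j+1} + 2 - l_j *)
Definition nmeas (L k j : nat) : nat := (lpar L k j.+1 + 2 - lpar L k j)%N.

Definition tpar (L k p j : nat) : nat := (nmeas L k j + p)%N.

Definition omega_par (L k r j s : nat) : R :=
  (expn 2 (lpar L k j - 1)%N)%:R * s%:R / r%:R.

(* Amplitude of the computational basis state |x_1>...|x_k>|c> in
   |phi_final>; xs = [:: x_1; ...; x_k]. *)
Definition phi_final_amp (L k p a N r : nat) (xs : seq nat) (c : nat) : R[i] :=
  rC (invsqrt r) *
  \sum_(s < r)
     ((\prod_(j < k) psi (tpar L k p j.+1) (omega_par L k r j.+1 s)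
                         (nth 0%N xs j)) * u_amp a N r s c).

Fixpoint sumtup (bs : seq nat) (F : seq nat -> R) : R :=
  match bs with
  | [::] => F [::]
  | b :: bs' => \sum_(i < b) sumtup bs' (fun xs => F (nat_of_ord i :: xs))
  end.

(* outcome m_j (j = 1..k, 1-based) of measuring basis state xs:
   for j < k the first nmeas_j (most significant) qubits of the
   t_j-qubit register A_j, for j = k the whole register *)
Definition outcome (L k p : nat) (xs : seq nat) (j : nat) : nat :=
  if (j < k)%N then (divn (nth 0%N xs j.-1) (expn 2 (tpar L k p j - nmeas L k j)%N))%N
  else nth 0%N xs j.-1.

Definition choose_c (lo hi : int) : option int :=
  if ((lo - hi) %% 4)%Z == 0 then Some 0
  else if ((lo + 1 - hi) %% 4)%Z == 0 then Some 1
  else if ((lo - 1 - hi) %% 4)%Z == 0 then Some (-1)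
  else None.

(* comb_aux d = m'_{k-d} (None = failure); ms j = m_j, 1-based *)
Fixpoint comb_aux (L k p : nat) (ms : nat -> nat) (d : nat) : option int :=
  match d with
  | 0 => Some (ms k)%:Z
  | d'.+1 =>
    match comb_aux L k p ms d' with
    | None => None
    | Some mp =>
      let u := (k - d'.+1)%N in
      (* length of m'_{u+1} is 2L + p + 2 - l_{u+1} *)
      let len := (2 * L + p + 2 - lpar L k u.+1)%N in
      let first2 := (mp %/ (2 ^+ (len - 2)%N))%Z in
      let rest := (mp %% (2 ^+ (len - 2)%N))%Z in
      let mu := (ms u)%:Z in
      match choose_c (mu %% 4)%Z first2 with
      | None => None
      | Some c =>
        let prefix := ((mu + c) %% (2 ^+ nmeas L k u))%Z in
        Some (prefix * 2 ^+ (len - 2)%N + rest)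
      end
    end
  end.

Definition combine_results (L k p : nat) (ms : nat -> nat) : option int :=
  comb_aux L k p ms (k - 1).

Definition good_output (L p r : nat) (m : int) : bool :=
  [exists s0 : 'I_r.+1,
     `| m%:~R / (expn 2 (2 * L + 1 + p)%N)%:R - (nat_of_ord s0)%:R / r%:R |
       <= ((expn 2 (2 * L + 1)%N)%:R : R)^-1].

Definition success_prob (L k p a N r : nat) : R :=
  sumtup [seq (expn 2 (tpar L k p j))%N | j <- iota 1 k]
    (fun xs => \sum_(c < expn 2 L)
        match combine_results L k p (outcome L k p xs) with
        | Some m => if good_output L p r m
                    then sqnorm (phi_final_amp L k p a N r xs c) else 0
        | None => 0
        end).

Definition is_order_mod (a N r : nat) : Prop :=
  (0 < r)%N /\ (modn (expn a r) N = modn 1 N)%N /\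
  (forall r', (0 < r')%N -> (r' < r)%N -> (modn (expn a r') N != modn 1 N)%N).

(* Main.v *)
(** The vectors [u_s] are orthonormal, so measuring yields the mixture over a
    uniform [s] of independent phase estimations of [2 ^ (l_j - 1) * s / r].
    By the Dirichlet-kernel tail bound, each register is within [2 ^ p - 1]
    (cyclically) of the true binary digits except with probability
    [1 / (2 * (2 ^ p - 2)) <= eps / k], and Bernoulli's inequality combines the
    [k] registers.  It remains to see that such outcomes always recombine:
    a carry in [m_u] and a borrow in [m'_(u+1)] can make the two overlapping bits
    disagree by 2, and this is excluded because [s / r] has denominator
    [r < 2 ^ L]: a borrow across [>= L] further bits forces the remaining
    fractional part of [s / r] to vanish, and then [m_u] carries no excess.
    Thus every [m'_u] carries the error of the last register [A_k] unchanged. *)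
Require Import Defs.
From Stdlib Require Import Rdefinitions.
From Stdlib Require Reals Lra.
From mathcomp Require Import all_boot all_order all_algebra.
From mathcomp Require Import complex Rstruct.
Import Order.TTheory GRing.Theory Num.Theory.
Local Open Scope ring_scope.

(** * Roots of unity *)

Module Jordan.
Import Reals Lra.
Local Open Scope R_scope.

(** Jordan's inequality, from the concavity of sine: a point below the chord would give mean slopes
    [cos c < 2 / PI < cos d] with [c < d], although cosine decreases there. *)
Lemma sin_ge_linear (x : R) : 0 <= x <= PI / 2 -> 2 * x / PI <= sin x.
Proof.
intros [x0 x1].
pose proof PI_RGT_0 as Hpi.
destruct (Rle_lt_dec (2 * x / PI) (sin x)) as [H|H]; [exact H|exfalso].
assert (Hx0 : 0 < x).
{ destruct x0 as [x0|x0]; [exact x0|]. subst x. rewrite sin_0 in H.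
  replace (2 * 0 / PI) with 0 in H by (field; lra). lra. }
assert (Hx1 : x < PI / 2).
{ destruct x1 as [x1|x1]; [exact x1|]. subst x. rewrite sin_PI2 in H.
  replace (2 * (PI / 2) / PI) with 1 in H by (field; lra). lra. }
destruct (MVT_cor2 sin cos 0 x Hx0) as [c [Hc Hc']].
{ intros; apply derivable_pt_lim_sin. }
destruct (MVT_cor2 sin cos x (PI/2) Hx1) as [d [Hd Hd']].
{ intros; apply derivable_pt_lim_sin. }
rewrite sin_0 in Hc. rewrite sin_PI2 in Hd.
assert (Hcd : cos d < cos c) by (apply cos_decreasing_1; lra).
assert (E : 2 * x / PI = (2 / PI) * x) by (field; lra).
assert (E2 : (2 / PI) * (PI / 2) = 1) by (field; lra).
assert (H1 : cos c < 2 / PI).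
{ apply (Rmult_lt_reg_r x); [lra|]. lra. }
assert (H2 : 2 / PI < cos d).
{ apply (Rmult_lt_reg_r (PI / 2 - x)); [lra|].
  rewrite Rmult_minus_distr_l. lra. }
lra.
Qed.
End Jordan.

(* Required only here because these tactics mask the ones used for Stdlib's reals. *)
From mathcomp Require Import ring lra zify.

(* By default the arguments of type [R] would be parsed in [R_scope], and [%Z]
   would denote Stdlib's [Z_scope] after the import of zify. *)
Bind Scope ring_scope with R.
Arguments cis th%_ring_scope : simpl never.
Arguments rC x%_ring_scope : simpl never.
Arguments psi t omega%_ring_scope x.
Arguments Rtrigo_def.sin x%_ring_scope.
Arguments Rtrigo_def.cos x%_ring_scope.
Delimit Scope int_scope with Z.

Lemma cis0 : cis 0 = 1.
Proof. by rewrite /cis Rtrigo_def.cos_0 Rtrigo_def.sin_0. Qed.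

Lemma cisD (x y : R) : cis (x + y) = cis x * cis y.
Proof.
rewrite /cis; apply/eqP; rewrite eq_complex /=.
by rewrite Cos_plus.cos_plus Rtrigo1.sin_plus; apply/andP; split; apply/eqP => //;
  rewrite addrC.
Qed.

Lemma cisX (x : R) n : cis (x * n%:R) = cis x ^+ n.
Proof.
elim: n => [|n IHn]; first by rewrite mulr0n mulr0 cis0 expr0.
by rewrite -natr1 mulrDr mulr1 cisD IHn exprSr.
Qed.

Definition cconj (z : R[i]) : R[i] := conjc z.
Arguments cconj : simpl never.

Lemma cis_conj (x : R) : cconj (cis x) = cis (- x).
Proof. by rewrite /cis /= Rtrigo1.cos_neg Rtrigo1.sin_neg. Qed.

Lemma cis2pi : cis (2%:R * Rpi) = 1.
Proof.
have -> : 2%:R * Rpi = Rmult 2 Rtrigo1.PI by [].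
by rewrite /cis Rtrigo1.cos_2PI Rtrigo1.sin_2PI.
Qed.

Lemma cis2pin n : cis (2%:R * Rpi * n%:R) = 1.
Proof. by rewrite cisX cis2pi expr1n. Qed.

(* The body of [sqnorm] is elaborated with [Rplus], which [ring] does not see as the
   addition of the ring [R]; likewise in [qft_invE], [pre_psiE] and [u_ampE]. *)
Lemma sqnormC (a b : R) : sqnorm (a +i* b)%C = a ^+ 2 + b ^+ 2.
Proof. by []. Qed.

Lemma complex_mulE (a b c d : R) :
  (a +i* b)%C * (c +i* d)%C = ((a * c - b * d) +i* (a * d + b * c))%C.
Proof. by []. Qed.

Lemma sqnormE (z : R[i]) : rC (sqnorm z) = z * cconj z.
Proof.
case: z => a b; rewrite sqnormC /cconj /conjc complex_mulE /rC; congr (_ +i* _)%C; ring.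
Qed.

Lemma sqnorm_ge0 z : 0 <= sqnorm z.
Proof. by case: z => a b; rewrite sqnormC addr_ge0 ?sqr_ge0. Qed.

Lemma sqnormM y z : sqnorm (y * z) = sqnorm y * sqnorm z.
Proof. case: y z => [a b] [c d]; rewrite complex_mulE !sqnormC; ring. Qed.

Lemma sqnorm_cis x : sqnorm (cis x) = 1.
Proof.
by rewrite /cis sqnormC addrC; have := Rtrigo1.sin2_cos2 x; rewrite /RIneq.Rsqr.
Qed.

Lemma sqnorm_rC x : sqnorm (rC x) = x ^+ 2.
Proof. by rewrite /rC sqnormC expr0n addr0. Qed.

Lemma sqnorm_1cis x : sqnorm (1 - cis x) = 4 * Rtrigo_def.sin (x / 2) ^+ 2.
Proof.
have H : Rtrigo_def.sin x ^+ 2 + Rtrigo_def.cos x ^+ 2 = 1.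
  exact: Rtrigo1.sin2_cos2.
have H2 : Rtrigo_def.cos x = 1 - 2 * (Rtrigo_def.sin (x / 2) * Rtrigo_def.sin (x / 2)).
  have E : x = Rmult 2 (x / 2).
    have -> : Rmult 2 (x / 2) = 2%:R * (x / 2) by [].
    by field.
  by rewrite mulrA {1}E; exact: Rtrigo1.cos_2a_sin.
have -> : sqnorm (1 - cis x) =
   (1 - Rtrigo_def.cos x) ^+ 2 + (0 - Rtrigo_def.sin x) ^+ 2 by [].
transitivity (1 + (Rtrigo_def.sin x ^+ 2 + Rtrigo_def.cos x ^+ 2) - 2 * Rtrigo_def.cos x).
  by ring.
by rewrite H H2; ring.
Qed.

Lemma rC_sum (I : finType) (F : I -> R) : rC (\sum_i F i) = \sum_i rC (F i).
Proof. exact: (raddf_sum (real_complex R)). Qed.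

Lemma rC_inj : injective rC.
Proof. by move=> x y []. Qed.

Lemma rCM x y : rC (x * y) = rC x * rC y.
Proof. exact: (rmorphM (real_complex R)). Qed.

Lemma rC_nat n : rC n%:R = n%:R.
Proof. exact: (rmorph_nat (real_complex R)). Qed.

Lemma Rpi_gt0 : 0 < Rpi.
Proof. by apply/RltP; exact: Rtrigo1.PI_RGT_0. Qed.

(** Jordan's inequality covers [u <= 1 / 2]; the other half follows from the symmetry of sine. *)
Lemma sin_pi_ge (u : R) : 0 <= u <= 1 ->
  2 * Num.min u (1 - u) <= Rtrigo_def.sin (Rpi * u).
Proof.
have half (v : R) : 0 <= v <= 1 / 2 -> 2 * v <= Rtrigo_def.sin (Rpi * v).
  move=> /andP[v0 v1]; have pi0 := Rpi_gt0.
  have /RleP : Rle (Rdiv (Rmult 2 (Rpi * v)) Rtrigo1.PI) (Rtrigo_def.sin (Rpi * v)).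
    apply: Jordan.sin_ge_linear; split; apply/RleP; first by rewrite mulr_ge0 // ltW.
    suff : Rpi * v <= Rpi * (1 / 2) by rewrite mul1r.
    by rewrite ler_pM2l.
  apply: le_trans.
  suff -> : Rdiv (Rmult 2 (Rpi * v)) Rtrigo1.PI = 2 * v by [].
  suff : (2 * (Rpi * v)) / Rpi = 2 * v by [].
  by field; rewrite gt_eqF.
move=> /andP[u0 u1]; case: (leP u (1 - u)) => h; first by apply: half; apply/andP; split; lra.
have := half (1 - u); have -> : Rpi * (1 - u) = Rminus Rtrigo1.PI (Rpi * u).
  by rewrite mulrBr mulr1.
rewrite Rtrigo_facts.sin_pi_minus; apply; apply/andP; split; lra.
Qed.

(** [Num.min u (1 - u)] is the distance from [u] to the nearest integer; the bound controls the
    denominator of the Dirichlet kernel. *)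
Lemma sqnorm_1cis_ge (u : R) : 0 <= u <= 1 ->
  16 * Num.min u (1 - u) ^+ 2 <= sqnorm (1 - cis (2 * Rpi * u)).
Proof.
move=> u01; have := sin_pi_ge _ u01; rewrite sqnorm_1cis.
have -> : 2 * Rpi * u / 2 = Rpi * u by field.
have m0 : 0 <= Num.min u (1 - u).
  by move: u01 => /andP[u0 u1]; rewrite le_min u0 subr_ge0.
move: (Num.min _ _) (Rtrigo_def.sin _) m0 => m s m0 h.
have : (2 * m) ^+ 2 <= s ^+ 2.
  by rewrite lerXn2r ?nnegrE ?mulr_ge0 // (le_trans _ h) ?mulr_ge0.
rewrite exprMn; lra.
Qed.

Lemma sqnorm_conj z : sqnorm (cconj z) = sqnorm z.
Proof. by case: z => a b; rewrite /cconj /conjc !sqnormC sqrrN. Qed.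

Lemma sqnorm_eq0 z : (sqnorm z == 0) = (z == 0).
Proof.
by case: z => a b; rewrite sqnormC paddr_eq0 ?sqr_ge0 // !sqrf_eq0 eq_complex.
Qed.

Lemma sqnorm_1cis_le x : sqnorm (1 - cis x) <= 4.
Proof.
rewrite sqnorm_1cis; set s := Rtrigo_def.sin _.
have : s ^+ 2 + Rtrigo_def.cos (x / 2) ^+ 2 = 1 by exact: Rtrigo1.sin2_cos2.
have := sqr_ge0 (Rtrigo_def.cos (x / 2)); lra.
Qed.

Lemma cis_neq1 (u : R) : 0 < u < 1 -> cis (2 * Rpi * u) != 1.
Proof.
move=> /andP[u0 u1]; rewrite eq_sym -subr_eq0 -sqnorm_eq0 gt_eqF //.
apply: lt_le_trans (sqnorm_1cis_ge _ _); last by rewrite !ltW.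
by rewrite mulr_gt0 // exprn_gt0 // lt_min u0 subr_gt0.
Qed.

(** * Geometric sums and orthogonality relations *)

Lemma geom_sum (z : R[i]) n : (1 - z) * (\sum_(j < n) z ^+ j) = 1 - z ^+ n.
Proof.
by rewrite -opprB mulNr -subrX1 opprB.
Qed.

Lemma cis_orthogonal (M i j : nat) : (i < M)%N -> (j < M)%N ->
  \sum_(x < M) cis (- (2 * Rpi * (i * x)%:R / M%:R)) *
              cconj (cis (- (2 * Rpi * (j * x)%:R / M%:R))) = (M * (i == j))%:R.
Proof.
move=> iM jM.
have M0 : (M%:R : R) != 0 by rewrite pnatr_eq0; lia.
have cc (x : R) : cis x * cconj (cis x) = 1.
  by rewrite -sqnormE sqnorm_cis.
case: eqVneq => [->|ij].
  rewrite (eq_bigr (fun=> 1)) => [|x _]; last exact: cc.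
  by rewrite sumr_const card_ord muln1.
(* [d] is [j - i] modulo [M], chosen strictly between 0 and [M] so that [z] below is an [M]-th root
   of unity other than 1. *)
have [d [e [d0 dM E]]] : exists d e : nat, [/\ (0 < d)%N, (d < M)%N & (j + M * e = i + d)%N].
  case: (ltnP i j) => h; first by exists (j - i)%N, 0%N; split; lia.
  by exists (j + M - i)%N, 1%N; split; lia.
set z := cis (2 * Rpi * (d%:R / M%:R)).
have zM : z ^+ M = 1.
  rewrite -cisX (_ : _ * M%:R = 2 * Rpi * d%:R) ?cis2pin //; by field.
rewrite muln0 (eq_bigr (fun x : 'I_M => z ^+ x)).
  apply/eqP; have /eqP := geom_sum z M; rewrite zM subrr mulf_eq0 subr_eq0 eq_sym.
  rewrite (negPf (cis_neq1 _ _)) //; have M1 : (0 < M)%N by lia.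
  by rewrite divr_gt0 ?ltr_pdivrMr ?mul1r ?ltr_nat ?ltr0n.
move=> x _; rewrite -cisX cis_conj -[LHS]mulr1 -{1}(cis2pin (e * x)) -!cisD; congr cis.
have Ej : j%:R = i%:R + d%:R - M%:R * e%:R :> R.
  by rewrite -natrD -E natrD natrM; ring.
by rewrite !natrM Ej; field.
Qed.

Lemma cconjM (y z : R[i]) : cconj (y * z) = cconj y * cconj z.
Proof. exact: (rmorphM (@conjc R)). Qed.

Lemma cconj_sum (I : finType) (F : I -> R[i]) :
  cconj (\sum_i F i) = \sum_i cconj (F i).
Proof. exact: (rmorph_sum (@conjc R)). Qed.

Lemma cconj_1sub z : cconj (1 - z) = 1 - cconj z.
Proof.
by rewrite /cconj (rmorphB (@conjc R)) (rmorph1 (@conjc R)).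
Qed.

(** Parseval's identity. It serves twice: for the inverse Fourier transform and for the vectors
    [u_amp]. *)
Lemma sqnorm_sum_orthonormal n m (b : 'I_n -> R[i]) (v : 'I_n -> 'I_m -> R[i]) :
  (forall s s', \sum_c v s c * cconj (v s' c) = (s == s')%:R) ->
  \sum_c sqnorm (\sum_s b s * v s c) = \sum_s sqnorm (b s).
Proof.
move=> ortho; apply: rC_inj; rewrite !rC_sum.
transitivity (\sum_c \sum_s \sum_s' (b s * cconj (b s')) * (v s c * cconj (v s' c))).
  apply: eq_bigr => c _; rewrite sqnormE cconj_sum big_distrlr /=.
  apply: eq_bigr => s _; apply: eq_bigr => s' _; rewrite cconjM; ring.
rewrite exchange_big; apply: eq_bigr => s _ /=.
rewrite exchange_big (bigD1 s) //= [X in _ + X]big1 => [|s' ss'].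
  by rewrite addr0 -big_distrr ortho eqxx /= ?mulr1n mulr1 sqnormE.
by rewrite -big_distrr ortho eq_sym (negPf ss') /= ?mulr0n mulr0.
Qed.

Lemma invsqrtM n : (0 < n)%N -> invsqrt n * invsqrt n = n%:R^-1.
Proof.
by move=> n0; rewrite /invsqrt -invfM -expr2 sqr_sqrtr ?ler0n.
Qed.

Lemma conj_rC x : cconj (rC x) = rC x.
Proof. by rewrite /rC /cconj /conjc oppr0. Qed.

Lemma qft_invE t x j :
  qft_inv t x j = rC (invsqrt (2 ^ t)) * cis (- (2 * Rpi * (j * x)%:R / (2 ^ t)%:R)).
Proof. by []. Qed.

Lemma pre_psiE t w j :
  pre_psi t w j = rC (invsqrt (2 ^ t)) * cis (2 * Rpi * j%:R * w).
Proof. by []. Qed.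

(** * Phase estimation *)

Lemma psi_norm t w : \sum_(x < 2 ^ t) sqnorm (psi t w x) = 1.
Proof.
have M0 : (0 < 2 ^ t)%N by rewrite expn_gt0.
have M0' : (2 ^ t)%:R != 0 :> R by rewrite pnatr_eq0 -lt0n.
pose v (j x : 'I_(2 ^ t)) := qft_inv t x j.
pose b (j : 'I_(2 ^ t)) := pre_psi t w j.
rewrite (eq_bigr (fun x => sqnorm (\sum_j b j * v j x))) => [|x _]; last first.
  by congr sqnorm; apply: eq_bigr => j _; rewrite mulrC.
rewrite sqnorm_sum_orthonormal => [|s s'].
  rewrite (eq_bigr (fun=> (2 ^ t)%:R^-1)) => [|x _].
    by rewrite sumr_const card_ord -[_ *+ _]mulr_natr mulVf.
  by rewrite /b pre_psiE sqnormM sqnorm_cis mulr1 sqnorm_rC expr2 invsqrtM.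
transitivity (rC (2 ^ t)%:R^-1 * (2 ^ t * (s == s'))%:R).
  rewrite -(cis_orthogonal _ _ _ (ltn_ord s) (ltn_ord s')) big_distrr /=.
  apply: eq_bigr => x _; rewrite /v !qft_invE cconjM conj_rC -invsqrtM // rCM; ring.
by rewrite natrM mulrA -rC_nat -rCM mulVf // mul1r.
Qed.

(** The amplitude is a geometric sum whose ratio [z] is conjugate to [cis (2 * Rpi * u)]. Its
    numerator satisfies [|1 - z^M|^2 <= 4], and [sqnorm_1cis_ge] handles the denominator. *)
Lemma sqnorm_psi_le t (w f u : R) (B l x q : nat) :
  (2 ^ t)%:R * w = B%:R + f -> 0 <= f < 1 -> (1 <= l < 2 ^ t)%N ->
  (x + 2 ^ t * q = B + l)%N -> u = (l%:R - f) / (2 ^ t)%:R ->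
  (4 * (2 ^ t)%:R ^+ 2) * Num.min u (1 - u) ^+ 2 * sqnorm (psi t w x) <= 1.
Proof.
move=> wE /andP[f0 f1] /andP[l1 lM] xE uE.
set M := (2 ^ t)%N in wE lM xE uE *.
have M0 : 0 < M%:R :> R by rewrite ltr0n expn_gt0.
have M0' : M%:R != 0 :> R by rewrite gt_eqF.
have l1' : 1 <= l%:R :> R by rewrite ler1n.
have lM' : l%:R < M%:R :> R by rewrite ltr_nat.
have u01 : 0 <= u <= 1.
  rewrite uE; apply/andP; split; last by rewrite ler_pdivrMr // mul1r; lra.
  by apply: divr_ge0; [lra|exact: ltW].
pose z := cis (2 * Rpi * (w - x%:R / M%:R)).
have -> : psi t w x = rC M%:R^-1 * (\sum_(j < M) z ^+ j).
  rewrite /psi big_distrr /=; apply: eq_bigr => j _.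
  rewrite qft_invE pre_psiE mulrACA -rCM invsqrtM ?expn_gt0 // -cisX.
  by rewrite -cisD; congr (_ * cis _); rewrite natrM; field.
have zE : cconj z = cis (2 * Rpi * u).
  rewrite /z cis_conj -[LHS]mulr1 -(cis2pin q) -cisD; congr cis.
  have wE' : w = (B%:R + f) / M%:R by rewrite -wE; field.
  have xE' : x%:R = B%:R + l%:R - M%:R * q%:R :> R.
    by rewrite -natrD -xE natrD natrM; ring.
  by rewrite wE' xE' uE; field.
have nz : sqnorm (1 - z) = sqnorm (1 - cis (2 * Rpi * u)).
  by rewrite -sqnorm_conj cconj_1sub zE.
rewrite sqnormM sqnorm_rC.
have S0 := sqnorm_ge0 (\sum_(j < M) z ^+ j).
have : 16 * Num.min u (1 - u) ^+ 2 * sqnorm (\sum_(j < M) z ^+ j) <= 4.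
  apply: le_trans (ler_wpM2r S0 (sqnorm_1cis_ge _ u01)) _.
  by rewrite -nz -sqnormM geom_sum -cisX sqnorm_1cis_le.
move: (Num.min _ _) (sqnorm _) S0 => m S S0 h.
have -> : 4 * M%:R ^+ 2 * m ^+ 2 * (M%:R^-1 ^+ 2 * S) = 4 * m ^+ 2 * S by field.
lra.
Qed.

(** With [M = 2^t], [M * u = l - f >= l - 1] and [M * (1 - u) = M - l + f >= M - l]. Adding the two
    resulting bounds replaces the minimum by something easy to sum over [l]. *)
Lemma psi_tail t (w f : R) (B l x q : nat) :
  (2 ^ t)%:R * w = B%:R + f -> 0 <= f < 1 -> (2 <= l < 2 ^ t)%N ->
  (x + 2 ^ t * q = B + l)%N ->
  sqnorm (psi t w x) <= (4 * (l.-1)%:R ^+ 2)^-1 + (4 * (2 ^ t - l)%:R ^+ 2)^-1.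
Proof.
move=> wE f01 /andP[l2 lM] xE.
have hl : (0 < l < 2 ^ t)%N by rewrite lM; lia.
have := sqnorm_psi_le t w f _ B l x q wE f01 hl xE erefl.
move: (sqnorm _) (sqnorm_ge0 (psi t w x)) => S S0.
have l1' : 1 <= (l.-1)%:R :> R by rewrite ler1n; lia.
have lE : l%:R = (l.-1)%:R + 1 :> R by rewrite natr1 prednK //; lia.
have y1 : 1 <= (2 ^ t - l)%:R :> R by rewrite ler1n; lia.
have yE : (2 ^ t)%:R = (2 ^ t - l)%:R + l%:R :> R by rewrite -natrD subnK // ltnW.
move: yE y1 wE; move: (2 ^ t)%:R (2 ^ t - l)%:R => M y yE y1 _ h.
have M0 : 0 < M by lra.
have key (a : R) : 1 <= a -> 4 * a ^+ 2 * S <= 1 -> S <= (4 * a ^+ 2)^-1.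
  move=> a1 ha; have a0 : 0 < 4 * a ^+ 2 by rewrite mulr_gt0 // exprn_gt0 //; lra.
  by rewrite -[leRHS]mul1r ler_pdivlMr // mulrC.
have mono (a c : R) : 1 <= a -> a <= c -> 4 * c ^+ 2 * S <= 1 -> 4 * a ^+ 2 * S <= 1.
  move=> a1 ac; apply: le_trans; apply: ler_wpM2r => //.
  by rewrite ler_pM2l // lerXn2r ?nnegrE //; lra.
have p0 (a : R) : 1 <= a -> 0 <= (4 * a ^+ 2)^-1.
  by move=> a1; rewrite invr_ge0 mulr_ge0 // sqr_ge0.
move: f01 => /andP[f0 f1].
move: h; case: (leP _ (1 - _)) => _ h.
  apply: (@le_trans _ _ (4 * l.-1%:R ^+ 2)^-1); last by rewrite lerDl p0.
  apply: key => //; apply: (mono _ (l%:R - f)); [by []|lra|].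
  apply: le_trans h; rewrite le_eqVlt; apply/orP; left; apply/eqP; field; by rewrite gt_eqF.
apply: (@le_trans _ _ (4 * y ^+ 2)^-1); last by rewrite lerDr p0.
apply: key => //; apply: (mono _ (y + f)); [by []|lra|].
apply: le_trans h; rewrite le_eqVlt; apply/orP; left; apply/eqP.
by rewrite yE; field; rewrite -yE gt_eqF.
Qed.

(* For [l] the offset, the phase [w - x / M] of [psi] is [(f - l) / M] modulo 1. *)
Definition offset (M B x : nat) : nat := ((x + (M - B %% M)) %% M)%N.

Definition close (M e B x : nat) : bool :=
  (offset M B x <= e)%N || (M - offset M B x <= e)%N.

Lemma offsetE M B x : (0 < M)%N -> (x < M)%N ->
  exists q, (x + M * q = B + offset M B x)%N.
Proof.
move=> M0 xM; have bM := ltn_pmod B M0.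
have eB := divn_eq B M; have eX := divn_eq (x + (M - B %% M)) M.
rewrite /offset; set b := (B %% M)%N in bM eB eX *; set l := ((_ + _) %% _)%N in eX *.
case: (posnP ((x + (M - b)) %/ M)%N) => [q0|q1].
  by exists (B %/ M).+1; move: eX; rewrite q0; nia.
exists (B %/ M - ((x + (M - b)) %/ M).-1)%N.
have : ((x + (M - b)) %/ M <= 1 + (B %/ M))%N; nia.
Qed.

Lemma sum_inv_sqr_le (a n : nat) : (1 < a)%N ->
  \sum_(a <= m < n) (m%:R ^+ 2)^-1 <= (a.-1%:R)^-1 :> R.
Proof.
move=> a1; have a0 : 0 < a.-1%:R :> R by rewrite ltr0n; lia.
case: (leqP a n) => an; last first.
  by rewrite big_geq ?invr_ge0 ?ltW // ltnW.
(* The telescoping bound [1/m^2 <= 1/(m-1) - 1/m] must keep its last term to pass through the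
   induction. *)
suff H : \sum_(a <= m < n) (m%:R ^+ 2)^-1 <= a.-1%:R^-1 - n.-1%:R^-1 :> R.
  by apply: le_trans H _; rewrite gerBl invr_ge0 ler0n.
rewrite -(subnKC an); elim: (n - a)%N => [|d IHd].
  by rewrite addn0 big_geq // subrr.
rewrite addnS big_nat_recr ?leq_addr //=.
apply: le_trans (lerD IHd (lexx _)) _.
have m0 : 0 < (a + d).-1%:R :> R by rewrite ltr0n; lia.
have -> : (a + d)%:R = (a + d).-1%:R + 1 :> R by rewrite natr1 prednK //; lia.
move: ((a + d).-1%:R) m0 => m m0.
rewrite -addrA lerD2l -subr_ge0.
have -> : - (m + 1)^-1 - (- m^-1 + ((m + 1) ^+ 2)^-1) = (m * (m + 1) ^+ 2)^-1 :> R.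
  by field; rewrite !gt_eqF //; lra.
by rewrite invr_ge0 mulr_ge0 ?ltW // exprn_gt0 //; lra.
Qed.

Lemma offset_inj M B : (0 < M)%N ->
  forall x y, (x < M)%N -> (y < M)%N -> offset M B x = offset M B y -> x = y.
Proof.
move=> M0 x y xM yM /eqP; rewrite /offset eqn_modDr !modn_small //.
by move/eqP.
Qed.

(** Outside [close] the offset satisfies [e < l < 2^t - e], and each of the two terms of [psi_tail]
    then sums to at most [1 / (4 * (e - 1))]. *)
Lemma qpe_close t e (w f : R) (B : nat) :
  (2 ^ t)%:R * w = B%:R + f -> 0 <= f < 1 -> (1 < e)%N ->
  1 - (2 * e.-1%:R)^-1 <=
    \sum_(x < 2 ^ t) (if close (2 ^ t) e B x then sqnorm (psi t w x) else 0).
Proof.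
move=> wE f01 e1; have M0 : (0 < 2 ^ t)%N by rewrite expn_gt0.
have e0 : 0 < e.-1%:R :> R by rewrite ltr0n; lia.
rewrite lerBlDr -big_mkcond /= -[leLHS](psi_norm t w).
rewrite (bigID (fun x : 'I_(2 ^ t) => close (2 ^ t) e B x)) /= lerD2l.
(* Taking the offset permutes the register values, so the tail can be indexed by the offset
   itself. *)
pose h (x : 'I_(2 ^ t)) := Ordinal (ltn_pmod (x + (2 ^ t - B %% 2 ^ t)) M0).
have h_inj : injective h.
  by move=> x y [] /(offset_inj _ _ M0 _ _ (ltn_ord x) (ltn_ord y)) /val_inj.
pose G (l : nat) : R := (4 * l.-1%:R ^+ 2)^-1 + (4 * (2 ^ t - l)%:R ^+ 2)^-1.
apply: (@le_trans _ _ (\sum_(x < 2 ^ t | (e < h x < 2 ^ t - e)%N) G (h x))).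
  rewrite (eq_bigl (fun x => (e < h x < 2 ^ t - e)%N)) => [|x]; last first.
    by rewrite /close negb_or -!ltnNge ltn_subRL addnC -ltn_subRL.
  apply: ler_sum => x /andP[hx1 hx2].
  have [q qE] := offsetE (2 ^ t) B x M0 (ltn_ord x).
  apply: (psi_tail t w f B _ x q) => //.
  by rewrite ltn_ord andbT; lia.
have -> : \sum_(x < 2 ^ t | (e < h x < 2 ^ t - e)%N) G (h x) =
          \sum_(x < 2 ^ t | (e < x < 2 ^ t - e)%N) G x.
  by rewrite [RHS](reindex_inj h_inj).
rewrite -(big_mkord (fun l => (e < l < 2 ^ t - e)%N) G).
have -> : \sum_(0 <= i < 2 ^ t | (e < i < 2 ^ t - e)%N) G i =
          \sum_(e.+1 <= i < 2 ^ t - e) G i.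
  rewrite [RHS](big_nat_widen _ _ (2 ^ t)) ?leq_subr // [RHS](big_nat_widenl _ 0%N) //.
  by apply: eq_bigl => i /=; rewrite andbC.
rewrite big_split /=.
have -> : (2 * e.-1%:R)^-1 = 4^-1 * e.-1%:R^-1 + 4^-1 * e.-1%:R^-1 :> R.
  by field; rewrite gt_eqF.
apply: lerD.
  rewrite big_add1 /=.
  rewrite (eq_bigr (fun i => 4^-1 * (i%:R ^+ 2)^-1)) => [|i _]; last by rewrite invfM.
  by rewrite -big_distrr /= ler_pM2l ?invr_gt0 //; apply: sum_inv_sqr_le.
rewrite big_nat_rev /=.
rewrite (eq_big_nat _ _ (F2 := fun i => 4^-1 * (i%:R ^+ 2)^-1)) => [|i hi]; last first.
  by rewrite -invfM; congr (4 * _%:R ^+ 2)^-1; lia.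
rewrite -big_distrr /= ler_pM2l ?invr_gt0 //.
apply: le_trans (sum_inv_sqr_le _ _ _) _ => //=; first by lia.
by rewrite lef_pV2 ?posrE ?ltr0n ?ler_nat //; lia.
Qed.

(** * The outcome distribution *)

Lemma eq_sumtup bs F G :
  (forall xs, F xs = G xs) -> sumtup bs F = sumtup bs G.
Proof.
elim: bs F G => [|b bs IH] F G FG /=; first exact: FG.
by apply: eq_bigr => i _; apply: IH => xs; apply: FG.
Qed.

Lemma ler_sumtup bs F G :
  (forall xs, size xs = size bs ->
     (forall i, (i < size bs)%N -> (nth 0%N xs i < nth 0%N bs i)%N) -> F xs <= G xs) ->
  sumtup bs F <= sumtup bs G.
Proof.
elim: bs F G => [|b bs IH] F G FG /=; first exact: FG.
apply: ler_sum => i _; apply: IH => xs sz lt; apply: FG => [|[|j] hj] /=.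
- by rewrite sz.
- exact: ltn_ord.
- exact: lt.
Qed.

Lemma sumtup_scale bs a F : sumtup bs (fun xs => a * F xs) = a * sumtup bs F.
Proof.
elim: bs F => [|b bs IH] F //=.
by rewrite big_distrr /=; apply: eq_bigr => i _; rewrite IH.
Qed.

Lemma sumtup_sum (I : finType) bs (F : I -> seq nat -> R) :
  sumtup bs (fun xs => \sum_s F s xs) = \sum_s sumtup bs (F s).
Proof.
elim: bs F => [|b bs IH] F //=.
by rewrite exchange_big /=; apply: eq_bigr => i _; rewrite IH.
Qed.

(** For fixed [s] the registers are independent; this factors the total weight of the tuples into
    one-register sums. *)
Lemma sumtup_prod bs (f : nat -> nat -> R) :
  sumtup bs (fun xs => \prod_(i < size bs) f i (nth 0%N xs i)) =
  \prod_(i < size bs) \sum_(x < nth 0%N bs i) f i x.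
Proof.
elim: bs f => [|b bs IH] f /=; first by rewrite !big_ord0.
rewrite big_ord_recl /= big_distrl /=; apply: eq_bigr => x _.
rewrite -(IH (fun i => f i.+1)) -sumtup_scale; apply: eq_sumtup => xs.
by rewrite big_ord_recl.
Qed.

Lemma bernoulli (q : R) n : 0 <= q <= 1 -> 1 - n%:R * q <= (1 - q) ^+ n.
Proof.
move=> /andP[q0 q1]; elim: n => [|n IH]; first by rewrite mulr0n mul0r subr0 expr0.
rewrite exprS; apply: (@le_trans _ _ ((1 - q) * (1 - n%:R * q))); last first.
  by rewrite ler_wpM2l // subr_ge0.
have : 0 <= n%:R * q ^+ 2 by rewrite mulr_ge0 ?ler0n ?sqr_ge0.
rewrite -natr1; lra.
Qed.

(** * Orthonormality of the vectors [u_s] *)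

Lemma expn_order_inj a N r : (0 < a)%N -> coprime a N -> is_order_mod a N r ->
  forall i j, (i < r)%N -> (j < r)%N -> (expn a i %% N = expn a j %% N)%N -> i = j.
Proof.
move=> a0 co [r0 [_ hmin]].
suff key i j : (i < j)%N -> (j < r)%N -> (expn a i %% N = expn a j %% N)%N -> False.
  move=> i j ir jr; case: (ltngtP i j) => // h.
    by move=> /(key _ _ h jr).
  by move=> /esym /(key _ _ h ir).
move=> ij jr /eqP; rewrite -(subnKC (ltnW ij)) expnD eq_sym.
rewrite -{2}[expn a i]muln1 eqn_mod_dvd; last first.
  by rewrite leq_mul2l expn_gt0 a0 orbT.
rewrite -mulnBr Gauss_dvdr; last by rewrite coprime_sym coprimeXl.
rewrite -eqn_mod_dvd ?expn_gt0 ?a0 // => h.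
by have := hmin (j - i)%N; rewrite h subn_gt0 ij => /(_ isT); lia.
Qed.

(** Pigeonhole on the residues of the powers. With [N < 2^L] it gives [r < 2^L], on which the carry
    analysis rests. *)
Lemma order_leq a N r : (0 < a)%N -> (0 < N)%N -> coprime a N -> is_order_mod a N r ->
  (r <= N)%N.
Proof.
move=> a0 N0 co ord; pose h (q : 'I_r) := Ordinal (ltn_pmod (expn a q) N0).
have h_inj : injective h.
  move=> x y [] E; apply: val_inj.
  exact: (expn_order_inj _ _ _ a0 co ord _ _ (ltn_ord x) (ltn_ord y) E).
by have := leq_card h h_inj; rewrite !card_ord.
Qed.

Lemma u_ampE a N r s c : u_amp a N r s c = rC (invsqrt r) *
  \sum_(q < r) (if (modn (expn a q) N == c)%N
                then cis (- (2 * Rpi * (s * q)%:R / r%:R)) else 0).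
Proof. by []. Qed.

(** Distinct [q] label distinct basis states, so only the terms [q = q'] survive the sum over [c];
    they form a character sum. *)
Lemma u_amp_orthonormal L a N r : (N < 2 ^ L)%N -> (0 < a)%N -> (0 < N)%N ->
  coprime a N -> is_order_mod a N r -> forall s s' : 'I_r,
  \sum_(c < 2 ^ L) u_amp a N r s c * cconj (u_amp a N r s' c) = (s == s')%:R.
Proof.
move=> NL a0 N0 co ord s s'; have r0 : (0 < r)%N by case: ord.
have kL q : (expn a q %% N < 2 ^ L)%N by apply: ltn_trans NL; apply: ltn_pmod.
pose k (q : 'I_r) := Ordinal (kL q).
have k_inj : injective k.
  move=> x y [] E; apply: val_inj.
  exact: (expn_order_inj _ _ _ a0 co ord _ _ (ltn_ord x) (ltn_ord y) E).
pose g (s q : 'I_r) := cis (- (2 * Rpi * (s * q)%:R / r%:R)).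
transitivity (rC r%:R^-1 * \sum_(q < r) g s q * cconj (g s' q)); last first.
  by rewrite cis_orthogonal // natrM mulrA -rC_nat -rCM mulVf ?mul1r // pnatr_eq0; lia.
transitivity (rC r%:R^-1 * \sum_(c < 2 ^ L) \sum_(q < r) \sum_(q' < r)
   (if (k q == c) && (k q' == c) then g s q * cconj (g s' q') else 0)).
  rewrite big_distrr /=; apply: eq_bigr => c _.
  rewrite !u_ampE cconjM conj_rC mulrACA -rCM invsqrtM //; congr (_ * _).
  rewrite cconj_sum big_distrlr /=; apply: eq_bigr => q _; apply: eq_bigr => q' _.
  rewrite -!(inj_eq val_inj) /=; case: eqP => _; last by rewrite mul0r.
  by case: eqP => _ //=; rewrite (_ : cconj 0 = 0) ?mulr0 // /cconj conjc0.
congr (_ * _); rewrite exchange_big /=; apply: eq_bigr => q _.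
rewrite exchange_big (bigD1 q) //= [X in _ + X]big1 => [|q' qq']; last first.
  rewrite big1 // => c _; case: eqP => //= <-; rewrite (inj_eq k_inj) (negPf qq') //.
rewrite addr0 (bigD1 (k q)) //= eqxx big1 ?addr0 // => c.
by rewrite eq_sym => /negPf ->.
Qed.

(** Summing over register [C] removes the cross terms in [s] and leaves a uniform mixture of product
    distributions. *)
Lemma phi_final_prob L k p a N r xs : (N < 2 ^ L)%N -> (0 < a)%N -> (0 < N)%N ->
  coprime a N -> is_order_mod a N r ->
  \sum_(c < 2 ^ L) sqnorm (phi_final_amp L k p a N r xs c) =
  r%:R^-1 * \sum_(s < r) \prod_(j < k)
    sqnorm (psi (tpar L k p j.+1) (omega_par L k r j.+1 s) (nth 0%N xs j)).
Proof.
move=> NL a0 N0 co ord; have r0 : (0 < r)%N by case: ord.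
rewrite (eq_bigr (fun c : 'I_(2 ^ L) => r%:R^-1 * sqnorm (\sum_(s < r)
     ((\prod_(j < k) psi (tpar L k p j.+1) (omega_par L k r j.+1 s)
                         (nth 0%N xs j)) * u_amp a N r s c)))) => [|c _]; last first.
  by rewrite /phi_final_amp sqnormM sqnorm_rC expr2 invsqrtM.
rewrite -big_distrr /=; congr (_ * _).
rewrite (sqnorm_sum_orthonormal _ _ (fun s : 'I_r => \prod_(j < k)
  psi (tpar L k p j.+1) (omega_par L k r j.+1 s) (nth 0%N xs j))
  (fun s c => u_amp a N r s c)); last exact: (u_amp_orthonormal L).
apply: eq_bigr => s _; apply: (big_morph sqnorm sqnormM).
by rewrite (_ : 1 = rC 1) // sqnorm_rC expr1n.
Qed.

(** * Combining the outcomes *)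

(** Serves to recognise a prefix followed by the remaining bits as one residue. *)
Lemma modz_mul_split (y b c : int) : 0 < b -> 0 < c ->
  (y %% (b * c))%Z = ((y %/ b)%Z %% c)%Z * b + (y %% b)%Z.
Proof.
move=> b0 c0; have bc0 : 0 < b * c by rewrite mulr_gt0.
have E1 := divz_eq y b; have E2 := divz_eq (y %/ b)%Z c.
have hb := ltz_pmod y b0; have hc := ltz_pmod (y %/ b)%Z c0.
have hb' := modz_ge0 y (lt0r_neq0 b0).
have hc' := modz_ge0 (y %/ b)%Z (lt0r_neq0 c0).
set w := ((y %/ b)%Z %% c)%Z in E2 hc hc' *; set t := (y %% b)%Z in E1 hb hb' *.
rewrite {1}E1 E2 (_ : _ + t = ((y %/ b)%Z %/ c)%Z * (b * c) + (w * b + t)); last by ring.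
by rewrite modzMDl modz_small //; apply/andP; split; nia.
Qed.

Lemma divz_mod_mul (y b c : int) : 0 < b -> 0 < c ->
  ((y %% (b * c))%Z %/ b)%Z = ((y %/ b)%Z %% c)%Z.
Proof.
move=> b0 c0; rewrite modz_mul_split // divzMDl ?lt0r_neq0 // [X in _ + X]divz_small ?addr0 //.
by rewrite modz_ge0 ?lt0r_neq0 //= gtz0_abs // ltz_pmod.
Qed.

(** -1, 0 and 1 are pairwise incongruent modulo 4, so the test that succeeds can only return
    [c1 - c2]. *)
Lemma choose_c_correct (H c1 c2 : int) : -1 <= c1 - c2 <= 1 ->
  choose_c ((H + c2) %% 4)%Z ((H + c1) %% 4)%Z = Some (c1 - c2).
Proof.
move=> h; rewrite /choose_c.
case: eqP => [h1|h1]; first by congr Some; lia.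
case: eqP => [h2|h2]; first by congr Some; lia.
case: eqP => [h3|h3]; first by congr Some; lia.
exfalso; lia.
Qed.

(* Here [P = 2^p], [rho / r] is the part of [2^n s / r] behind the last bit of [m_u],
   and [A], [a] are its leading digits as seen by [m'_(u+1)] and [m_u].  If
   [rho > 0] then [rho / r > 1 / K], so [A >= P > |d|] and there is no borrow;
   if [rho = 0] then [a = 0], so [m_u] has no upward carry. *)
Lemma carry_range (P K r rho A a d du : int) :
  0 < P -> 0 < r < K -> 0 <= rho < r ->
  A * r <= P * K * rho < A * r + r -> a * r <= P * rho < a * r + r ->
  `|d| < P -> `|du| < P ->
  [/\ -1 <= ((A + d) %/ (P * K))%Z - ((a + du) %/ P)%Z <= 1 & A + d < P * K].
Proof.
move=> P0 /andP[r0 rK] /andP[rho0 rho1] /andP[A1 A2] /andP[a1 a2] hd hdu.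
have PK : P <= P * K by nia.
(* Since [rho <= r - 1] and [r < K], [A] stays at least [P] below [P * K], so adding [d] cannot
   carry upward. *)
have Alt : A + P <= P * K.
  have : A * r <= P * K * (r - 1) by apply: le_trans A1 _; nia.
  have : P * r <= P * K by nia.
  nia.
split; last by lia.
have divP (y : int) (b q : int) : 0 < b -> q * b <= y < q * b + b -> (y %/ b)%Z = q.
  move=> b0 /andP[y1 y2].
  by rewrite (_ : y = q * b + (y - q * b)) ?divzMDl ?lt0r_neq0 ?divz_small ?addr0 //;
    [apply/andP; split; lia | lia].
case: (eqVneq rho 0) => [z|nz].
  have -> : A = 0 by nia.
  have -> : a = 0 by nia.
  rewrite !add0r.
  have : (d %/ (P * K))%Z = (if 0 <= d then 0 else -1).
    by apply: divP; [lia|case: ifP; lia].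
  have : (du %/ P)%Z = (if 0 <= du then 0 else -1).
    by apply: divP; [lia|case: ifP; lia].
  by do 2 case: ifP; lia.
have rho1' : 1 <= rho by lia.
have A3 : P <= A.
  have : P * r <= P * K * rho by nia.
  nia.
have a0 : 0 <= a < P.
  by apply/andP; split; nia.
have -> : ((A + d) %/ (P * K))%Z = 0 by apply: divP; lia.
have : ((a + du) %/ P)%Z = (if a + du < 0 then -1 else if P <= a + du then 1 else 0).
  by apply: divP => //; case: ifP; [|case: ifP]; lia.
by case: ifP; [|case: ifP]; lia.
Qed.

(** [H] holds the true digits up to the last bit of [m_u]; [c1] and [c2] are the carries into it
    from [m'_(u+1)] and within [m_u]. The correction [c1 - c2] trades the second carry for the
    first, so the longer string is again a residue of [X], with the same error [d]. As 4 divides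
    [Q], the cyclic wraps [q * Q] do not affect the overlap test. *)
Lemma combine_step (H P K Q r rho A a d du q : int) (Qn : Q = 4 * (Q %/ 4)%Z) :
  0 < P -> 0 < Q -> 0 < r < K -> 0 <= rho < r ->
  A * r <= P * K * rho < A * r + r -> a * r <= P * rho < a * r + r ->
  `|d| < P -> `|du| < P ->
  let X := H * (P * K) + A + d in
  let m := ((H * P + a + du + q * (Q * P)) %/ P)%Z in
  let mp := (X %% (P * K * 4))%Z in
  exists2 c, choose_c (m %% 4)%Z (mp %/ (P * K))%Z = Some c &
    ((m + c) %% Q)%Z * (P * K) + (mp %% (P * K))%Z = (X %% (P * K * Q))%Z.
Proof.
move=> P0 Q0 rK rho01 hA ha hd hdu X m mp.
have [hc _] := carry_range _ _ _ _ _ _ _ _ P0 rK rho01 hA ha hd hdu.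
have PK0 : 0 < P * K by rewrite mulr_gt0 //; lia.
set c1 := (_ %/ (P * K))%Z in hc; set c2 := (_ %/ P)%Z in hc.
have mE : m = H + c2 + q * Q.
  rewrite /m (_ : _ + _ = (H + q * Q) * P + (a + du)); last by ring.
  by rewrite divzMDl ?lt0r_neq0 // /c2; lia.
have XE : (X %/ (P * K))%Z = H + c1.
  by rewrite /X -addrA divzMDl ?lt0r_neq0.
exists (c1 - c2).
  rewrite /mp divz_mod_mul // XE mE.
  rewrite (_ : ((H + c2 + q * Q) %% 4)%Z = ((H + c2) %% 4)%Z) ?choose_c_correct //.
  by rewrite Qn (_ : _ + _ = q * (Q %/ 4)%Z * 4 + (H + c2)) ?modzMDl //; ring.
rewrite [RHS]modz_mul_split // XE mE (_ : _ + (c1 - c2) = q * Q + (H + c1)); last by ring.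
rewrite modzMDl /mp; congr (_ + _).
rewrite [in RHS](divz_eq X (P * K * 4)).
rewrite (_ : _ * (P * K * 4) = (X %/ (P * K * 4))%Z * 4 * (P * K)).
  by rewrite modzMDl.
by ring.
Qed.

(** A small offset [l] is the signed error [l], an offset near [M] is the error [l - M]; [q] absorbs
    whole turns. *)
Lemma close_int M e B x : (x < M)%N -> close M e B x ->
  exists d q : int, `|d| <= e%:Z /\ x%:Z = B%:Z + d + q * M%:Z.
Proof.
move=> xM; have M0 : (0 < M)%N by lia.
have [q qE] := offsetE M B x M0 xM; have lM : (offset M B x < M)%N by apply: ltn_pmod.
rewrite /close; move: (offset M B x) qE lM => l qE lM /orP[h|h].
  by exists l%:Z, (- q%:Z); split; nia.
by exists (l%:Z - M%:Z), (1 - q%:Z); split; nia.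
Qed.

(** Splits the expansion after the digits of [y %/ r], with [A] coming from the remainder alone.
    Applied to one [y] with two values of [h], it compares what two registers see. *)
Lemma floor_scale (y r h : nat) : (0 < r)%N -> exists A : nat,
  (h * y %/ r = (y %/ r) * h + A)%N /\ (A * r <= h * (y %% r) < A * r + r)%N.
Proof.
move=> r0; exists (h * (y %% r) %/ r)%N; split.
  by rewrite [in LHS](divn_eq y r) mulnDr mulnA divnMDl // mulnC.
have := divn_eq (h * (y %% r)) r; have := ltn_pmod (h * (y %% r)) r0; nia.
Qed.

(** Clears denominators: an error of [2^p] on the scale [2^(2L+1+p)] is the required [2^-(2L+1)]. *)
Lemma good_outputI L p r s0 (m : int) : (0 < r)%N -> (s0 <= r)%N ->
  `|m * r%:Z - (2 ^ (2 * L + 1 + p))%:Z * s0%:Z| <= (2 ^ p)%:Z * r%:Z ->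
  good_output L p r m.
Proof.
move=> r0 s0r h; apply/existsP; exists (Ordinal (s0r : s0 < r.+1)%N) => /=.
rewrite expnD natrM; rewrite expnD PoszM in h.
set E := (2 ^ (2 * L + 1))%N in h *; set P := (2 ^ p)%N in h *.
have E0 : 0 < E%:R :> R by rewrite ltr0n expn_gt0.
have P0 : 0 < P%:R :> R by rewrite ltr0n expn_gt0.
have r0' : 0 < r%:R :> R by rewrite ltr0n.
have h' : `|m%:~R * r%:R - E%:R * P%:R * s0%:R| <= P%:R * r%:R :> R.
  by move: h; rewrite -(ler_int R) intr_norm rmorphB !rmorphM.
have -> : m%:~R / (E%:R * P%:R) - s0%:R / r%:R =
    (m%:~R * r%:R - E%:R * P%:R * s0%:R) / (E%:R * P%:R * r%:R) :> R.
  by field; rewrite !gt_eqF.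
rewrite normrM normfV (ger0_norm (_ : 0 <= _ * _ * _)); last by rewrite !mulr_ge0 ?ltW.
rewrite ler_pdivrMr ?mulr_gt0 //; apply: le_trans h' _.
by rewrite le_eqVlt; apply/orP; left; apply/eqP; field; rewrite gt_eqF.
Qed.

(** * Recombination when every register is close *)

Section Combine.
Variables (L k p r s : nat) (xs : seq nat).
Hypotheses (L0 : (0 < L)%N) (k0 : (0 < k)%N) (kL : (k %| L)%N).
Hypotheses (r0 : (0 < r)%N) (rL : (r < 2 ^ L)%N) (sr : (s < r)%N).

Lemma lparE j : (j < k)%N -> lpar L k j.+1 = (j * (L %/ k) + 1)%N.
Proof.
move=> jk; rewrite /lpar eqSS ltn_eqF // subn1 /=.
by rewrite -{1}(divnK kL) mulnA mulnK.
Qed.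

Lemma lpar_last : lpar L k k.+1 = (2 * L)%N.
Proof. by rewrite /lpar eqxx. Qed.

Lemma stride_gt0 : (0 < L %/ k)%N.
Proof. by rewrite divn_gt0 // dvdn_leq. Qed.

(** Ensures [2 * L - l_j >= L], so that [r < 2^L] yields the hypothesis [r < K] of
    [combine_step]. *)
Lemma lpar_leq j : (j < k)%N -> (lpar L k j.+1 <= L)%N.
Proof.
move=> jk; rewrite lparE //; have := stride_gt0; have := divnK kL; nia.
Qed.

Lemma nmeasE j : (j.+1 < k)%N -> nmeas L k j.+1 = (L %/ k + 2)%N.
Proof. by move=> jk; rewrite /nmeas !lparE //; lia. Qed.

(** Integer part of [2^t_j] times the phase [omega_par], left unreduced modulo [2^t_j]; [offset]
    does the reduction. *)
Definition reg_floor (j : nat) : nat :=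
  ((2 ^ (tpar L k p j + lpar L k j - 1) * s) %/ r)%N.

Hypothesis xs_lt : forall j, (j < k)%N -> (nth 0%N xs j < 2 ^ tpar L k p j.+1)%N.
Hypothesis xs_close : forall j, (j < k)%N ->
  close (2 ^ tpar L k p j.+1) (2 ^ p - 1) (reg_floor j.+1) (nth 0%N xs j).

Let T := (2 * L + 1 + p)%N.
(** The error-free output: [s / r] truncated to [T] bits. *)
Let DT := ((2 ^ T * s) %/ r)%N.

Lemma natz_exp n : (2 ^ n)%N%:Z = 2 ^+ n.
Proof. by rewrite -[LHS]natz natrX. Qed.

(** The error [d] is that of register [A_k], fixed before [i]; by induction each merge only extends
    the string to a longer residue of [DT + d]. *)
Lemma comb_auxE : exists d : int, `|d| < (2 ^ p)%N%:Z /\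
  forall i, (i < k)%N -> comb_aux L k p (outcome L k p xs) i =
    Some ((DT%:Z + d) %% (2 ^ (2 * L + p + 2 - lpar L k (k - i)))%N%:Z)%Z.
Proof.
have P0 : (0 < 2 ^ p)%N by rewrite expn_gt0.
have [j kE] : exists j, k = j.+1 by exists k.-1; rewrite prednK.
have jk : (j < k)%N by lia.
have := close_int _ _ _ _ (xs_lt _ jk) (xs_close _ jk).
have ll := lpar_leq _ jk.
have tE : tpar L k p j.+1 = (2 * L + p + 2 - lpar L k j.+1)%N.
  have ll' : (lpar L k k <= L)%N by rewrite [in leqLHS](_ : lpar L k k = lpar L k j.+1) // kE.
  by rewrite /tpar /nmeas -kE lpar_last; lia.
(* As [l_(k+1) = 2L], we have [t_k + l_k - 1 = T]. *)
have -> : reg_floor j.+1 = DT.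
  by rewrite /reg_floor tE; congr ((2 ^ _ * s) %/ r)%N; rewrite /T; lia.
move=> [d [q [dP xE]]]; exists d; split; first by lia.
elim=> [|i IH] ik.
  have lkE : lpar L k (k - 0) = lpar L k j.+1 by rewrite (_ : k - 0 = j.+1)%N //; lia.
  have kj : k.-1 = j by lia.
  rewrite lkE -tE /= /outcome ltnn kj; congr Some.
  have -> : DT%:Z + d = (- q) * (2 ^ tpar L k p j.+1)%N%:Z + (nth 0%N xs j)%:Z.
    by rewrite xE; ring.
  by rewrite modzMDl modz_small // ltz_nat xs_lt.
have {}IH := IH (ltnW ik).
have [u uE] : exists u, (k - i.+1 = u.+1)%N by exists (k - i.+1).-1; lia.
have uk : (u.+1 < k)%N by lia.
have uk' : (u < k)%N by lia.
have iE : (k - i = u.+2)%N by lia.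
have l2 := lpar_leq _ uk.
have l1E := lparE _ uk'; have l2E := lparE _ uk.
have nE := nmeasE _ uk.
set l := lpar L k u.+2 in l2 l2E.
have tuE : tpar L k p u.+1 = (L %/ k + 2 + p)%N by rewrite /tpar nE.
have := close_int _ _ _ _ (xs_lt _ uk') (xs_close _ uk').
move=> [du [qu [duP xuE]]].
(* [y / r] is [s / r] with the binary point moved right behind the last measured bit of register
   [u.+1], two bits into the next register. Quotient and remainder become [H] and [rho] in
   [combine_step]. *)
pose y := (2 ^ (l + 1) * s)%N.
have [A [AE A1]] := floor_scale y r (2 ^ (2 * L - l + p)) r0.
have [a [aE a1]] := floor_scale y r (2 ^ p) r0.
have DTE : DT = ((y %/ r) * 2 ^ (2 * L - l + p) + A)%N.
  have TE : (2 * L - l + p + (l + 1))%N = T by rewrite /T; clear -l2; lia.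
  by rewrite -AE /DT /y mulnA -expnD TE.
have BuE : reg_floor u.+1 = ((y %/ r) * 2 ^ p + a)%N.
  rewrite -aE /reg_floor /y mulnA -expnD.
  have tlE : (tpar L k p u.+1 + lpar L k u.+1 - 1 = p + (l + 1))%N.
    rewrite tuE l1E l2E mulSn.
    have arith (n x : nat) : (n + 2 + p + (x + 1) - 1 = p + (n + x + 1 + 1))%N.
      by clear; lia.
    exact: arith.
  by rewrite tlE.
have outE : outcome L k p xs u.+1 = (nth 0%N xs u %/ 2 ^ p)%N.
  by rewrite /outcome uk /= /tpar addKn.
rewrite uE; set ms := outcome L k p xs in IH outE *.
rewrite /= IH iE uE outE -/l nE.
have lenE : (2 * L + p + 2 - l - 2 = 2 * L - l + p)%N by clear -l2; lia.
set P := (2 ^ p)%N%:Z; set K := (2 ^ (2 * L - l))%N%:Z.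
set Q := (2 ^ (L %/ k + 2))%N%:Z.
have PKE : (2 ^ (2 * L - l + p))%N%:Z = P * K by rewrite addnC expnD PoszM.
have e1 : 2 ^+ (2 * L + p + 2 - l - 2) = P * K by rewrite lenE -natz_exp.
have e2 : (2 ^ (2 * L + p + 2 - l))%N%:Z = P * K * 4.
  rewrite -PKE -PoszM -(expnD 2 _ 2); congr (2 ^ _)%N%:Z; clear -l2; lia.
have e3 : (2 ^ (2 * L + p + 2 - lpar L k u.+1))%N%:Z = P * K * Q.
  rewrite -PKE -PoszM -expnD; congr (2 ^ _)%N%:Z.
  have l2E' : l = (L %/ k + lpar L k u.+1)%N by rewrite l2E l1E mulSn addnA.
  have arith (c1 c2 c3 : nat) : c1 = (c3 + c2)%N -> (c1 <= L)%N ->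
    (2 * L + p + 2 - c2 = 2 * L - c1 + p + (c3 + 2))%N by clear; lia.
  exact: arith l2E' l2.
have e4 : (nth 0%N xs u %/ 2 ^ p)%N%:Z =
    (((y %/ r)%N%:Z * P + a%:Z + du + qu * (Q * P)) %/ P)%Z.
  by rewrite -divz_nat xuE BuE tuE expnD !PoszD !PoszM.
have e5 : DT%:Z + d = (y %/ r)%N%:Z * (P * K) + A%:Z + d.
  by rewrite DTE PoszD PoszM PKE.
have hr : 0 < r%:Z < K.
  rewrite !ltz_nat r0; apply: leq_trans rL _; rewrite leq_exp2l //; clear -l2; lia.
have hrho : 0 <= (y %% r)%N%:Z < r%:Z by rewrite ltz_nat ltn_pmod.
have hA : A%:Z * r%:Z <= P * K * (y %% r)%N%:Z < A%:Z * r%:Z + r%:Z.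
  by rewrite -PKE -!PoszM -PoszD lez_nat ltz_nat.
have ha : a%:Z * r%:Z <= P * (y %% r)%N%:Z < a%:Z * r%:Z + r%:Z.
  by rewrite -!PoszM -PoszD lez_nat ltz_nat.
have lt (v : int) : `|v| <= (2 ^ p - 1)%N%:Z -> `|v| < P.
  by move=> h; apply: le_lt_trans h _; rewrite ltz_nat subn1 prednK.
have Q4 : Q = 4 * (Q %/ 4)%Z.
  by rewrite /Q expnD PoszM mulzK // mulrC.
have P0' : 0 < P by rewrite ltz_nat.
have Q0 : 0 < Q by rewrite ltz_nat expn_gt0.
have [c cE prefE] := combine_step (y %/ r)%N%:Z P K Q _ _ _ _ d du qu Q4
  P0' Q0 hr hrho hA ha (lt _ dP) (lt _ duP).
rewrite e1 e2 e3 e4 e5 -natz_exp cE; congr Some; exact: prefE.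
Qed.

(** The output is [DT + d] modulo [2^T], so only a wrap could spoil it. [carry_range] excludes
    overflow at the top, and a wrap at the bottom turns out to be harmless. *)
Lemma combine_results_good : exists2 m,
  combine_results L k p (outcome L k p xs) = Some m & good_output L p r m.
Proof.
have P0 : (0 < 2 ^ p)%N by rewrite expn_gt0.
have [d [dP combE]] := comb_auxE.
have := combE (k - 1)%N; rewrite (_ : (k - 1 < k)%N); last by clear -k0; lia.
move=> /(_ isT) {}combE; eexists; first exact: combE.
have -> : (k - (k - 1) = 1)%N by clear -k0; lia.
have -> : lpar L k 1 = 1%N by rewrite lparE.
rewrite (_ : (2 * L + p + 2 - 1)%N = T); last by rewrite /T; clear; lia.
set P := (2 ^ p)%N%:Z in dP; set K := (2 ^ (2 * L + 1))%N%:Z.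
have TE : (2 ^ T)%N%:Z = P * K by rewrite /T expnD PoszM mulrC.
have [A0 []] := floor_scale s r (2 ^ T) r0.
rewrite (divn_small sr) mul0n add0n (modn_small sr) => <- {A0}; rewrite -/DT => hA.
have hr : 0 < r%:Z < K.
  rewrite !ltz_nat r0; apply: leq_trans rL _; rewrite leq_exp2l //; clear; lia.
have hs : 0 <= s%:Z < r%:Z by rewrite ltz_nat.
have hA' : DT%:Z * r%:Z <= P * K * s%:Z < DT%:Z * r%:Z + r%:Z.
  by rewrite -TE -!PoszM -PoszD lez_nat ltz_nat.
have P0' : 0 < P by rewrite ltz_nat.
have [a [_ ha]] := floor_scale s r (2 ^ p) r0; rewrite modn_small // in ha.
have ha' : a%:Z * r%:Z <= P * s%:Z < a%:Z * r%:Z + r%:Z.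
  by rewrite -!PoszM -PoszD lez_nat ltz_nat.
have [_ ltPK] := carry_range _ _ _ _ _ _ _ _ P0' hr hs hA' ha' dP dP.
have PK : P <= P * K by rewrite ler_peMr ?ltW //; move: hr; clear; lia.
case: (lerP 0 (DT%:Z + d)) => [X0|X0].
  rewrite modz_small ?X0 ?TE //.
  apply: (good_outputI _ _ _ s) => //; first exact: ltnW.
  rewrite -/T TE -/P; move: hA' dP; move: (P * K * s%:Z) r0 P0'; clear; nia.
(* For [s > 0], [r < K] would give [DT >= P > |d|], so a negative sum forces [s = 0]. *)
have s0 : s = 0%N.
  move: X0 dP hA' hr ltPK; clear; move: (DT) => D; case: s => // s'; nia.
have D0 : DT = 0%N by rewrite /DT s0 muln0 div0n.
rewrite D0 add0r in X0 *.
rewrite -(modzMDl 1) mul1r modz_small TE; last first.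
  by move: X0 dP PK; clear; lia.
(* The output has wrapped to [2^T + d], which is close to the fraction [r / r = 1]. *)
apply: (good_outputI _ _ _ r) => //.
rewrite -/T TE -/P; move: dP; move: (P * K) r0 P0'; clear; nia.
Qed.

End Combine.

(** * The probability bound *)

(** This is [qpe_close] with [e = 2^p - 1]: since [2^t_j] times the phase is
    [2^(t_j + l_j - 1) * s / r], its integer part is [reg_floor] and its fractional part a remainder
    over [r]. *)
Lemma qpe_register L k p r s j :
  (1 < p)%N -> (0 < r)%N -> (j < k)%N -> (k %| L)%N -> (0 < k)%N ->
  1 - (2 * (2 ^ p - 2)%:R)^-1 <=
  \sum_(x < 2 ^ tpar L k p j.+1)
    (if close (2 ^ tpar L k p j.+1) (2 ^ p - 1) (reg_floor L k p r s j.+1) x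
     then sqnorm (psi (tpar L k p j.+1) (omega_par L k r j.+1 s) x) else 0).
Proof.
move=> p1 r0 jk kL k0.
have r0' : 0 < r%:R :> R by rewrite ltr0n.
have -> : (2 ^ p - 2)%N = (2 ^ p - 1).-1 by lia.
have p4 : (4 <= 2 ^ p)%N by rewrite (@leq_exp2l 2 2).
set t := tpar L k p j.+1; set y := (2 ^ (t + lpar L k j.+1 - 1) * s)%N.
apply: (qpe_close _ _ _ ((y %% r)%N%:R / r%:R)).
- have -> : omega_par L k r j.+1 s = (2 ^ (lpar L k j.+1 - 1))%:R * s%:R / r%:R by [].
  rewrite !mulrA -!natrM -expnD (_ : (t + _)%N = (t + lpar L k j.+1 - 1)%N).
    rewrite -/y {1}(divn_eq y r) natrD natrM /reg_floor -/t -/y; field.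
    by rewrite gt_eqF.
  by rewrite addnBA // lparE // addn1.
- rewrite divr_ge0 ?ler0n //= ltr_pdivrMr // mul1r ltr_nat ltn_pmod //.
- lia.
Qed.

Theorem theorem1 (L k N a r p : nat) (eps : R) :
  (1 <= L)%N -> (1 <= k)%N -> (k %| L)%N ->
  (expn 2 (L - 1)%N <= N)%N -> (N < expn 2 L)%N ->
  (0 < a)%N -> (a < N)%N -> coprime a N ->
  is_order_mod a N r ->
  0 < eps ->
  (* p = ceil(log2(2 + 1/(2 eps'))), eps' = eps / k *)
  ((2 + (2 * (eps / k%:R))^-1) <= (expn 2 p)%:R) ->
  ((expn 2 (p - 1)%N)%:R < 2 + (2 * (eps / k%:R))^-1) ->
  1 - eps <= success_prob L k p a N r.
Proof.
move=> L0 k0 kL _ NL a0 aN co ord eps0 hp _.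
have r0 : (0 < r)%N by case: ord.
have N0 : (0 < N)%N by apply: leq_ltn_trans aN.
have rL : (r < 2 ^ L)%N by apply: leq_ltn_trans (order_leq _ _ _ a0 N0 co ord) NL.
have k0' : 0 < k%:R :> R by rewrite ltr0n.
set eps' := eps / k%:R in hp.
have eps'0 : 0 < eps' by rewrite divr_gt0.
have i0 : 0 < (2 * eps')^-1 by rewrite invr_gt0 mulr_gt0.
have p1 : (1 < p)%N.
  have : (2 ^ 1 < 2 ^ p)%N by rewrite -(ltr_nat R); lra.
  by rewrite ltn_exp2l.
have p4 : (4 <= 2 ^ p)%N by rewrite (@leq_exp2l 2 2).
have e2 : 2 <= (2 ^ p - 2)%:R :> R by rewrite (ler_nat _ 2); lia.
set q := (2 * (2 ^ p - 2)%:R)^-1 : R.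
(* The choice of [p] gives [2^p - 2 >= 1 / (2 * eps')], hence a failure probability of at most
   [eps / k] per register. *)
have qe : q <= eps'.
  have h : (2 * eps')^-1 <= (2 ^ p - 2)%:R by rewrite natrB ?lerBrDl // (leq_trans _ p4).
  rewrite /q; move: (2 ^ p - 2)%:R e2 h => y y2 h; have y0 : 0 < y by lra.
  have e20 : 0 < 2 * eps' by rewrite mulr_gt0.
  have y20 : 0 < 2 * y by rewrite mulr_gt0.
  have {}h : 1 <= y * (2 * eps').
    by rewrite -(ler_pdivrMr _ _ e20) mul1r.
  rewrite -[leLHS]mul1r (ler_pdivrMr _ _ y20).
  by have -> : eps' * (2 * y) = y * (2 * eps') by ring.
have q01 : 0 <= q <= 1.
  rewrite invr_ge0 mulr_ge0 //= ?invf_le1 ?mulr_gt0 //; lra.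
pose f (s j x : nat) : R :=
  if close (2 ^ tpar L k p j.+1) (2 ^ p - 1) (reg_floor L k p r s j.+1) x
  then sqnorm (psi (tpar L k p j.+1) (omega_par L k r j.+1 s) x) else 0.
set bs := [seq (2 ^ tpar L k p j)%N | j <- iota 1 k].
have bsk : size bs = k by rewrite size_map size_iota.
have nbs j : (j < k)%N -> nth 0%N bs j = (2 ^ tpar L k p j.+1)%N.
  by move=> jk; rewrite (nth_map 0%N) ?size_iota // nth_iota // add1n.
(* The intermediate quantity averages over [s] the weight of the tuples close in every register.
   Bernoulli bounds it from below; the success probability dominates it tuple by tuple. *)
apply: (@le_trans _ _ (sumtup bs (fun xs =>
  r%:R^-1 * \sum_(s < r) \prod_(j < size bs) f s j (nth 0%N xs j)))).
  rewrite sumtup_scale sumtup_sum.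
  apply: (@le_trans _ _ ((1 - q) ^+ k)).
    apply: le_trans (bernoulli _ k q01); rewrite lerD2l lerN2.
    by rewrite mulrC -ler_pdivlMr.
  have -> : (1 - q) ^+ k = r%:R^-1 * \sum_(s < r) (1 - q) ^+ k.
    rewrite sumr_const card_ord -[X in _ * X]mulr_natl mulrA mulVf ?mul1r //.
    by rewrite pnatr_eq0 -lt0n.
  rewrite ler_pM2l ?invr_gt0 ?ltr0n //; apply: ler_sum => s _.
  rewrite sumtup_prod -{1}bsk -[X in _ ^+ X]card_ord -prodr_const.
  apply: ler_prod => j _; rewrite subr_ge0; case/andP: q01 => _ -> /=.
  have jk : (j < k)%N by rewrite -bsk.
  by rewrite nbs //; apply: qpe_register.
apply: ler_sumtup => xs sz lt.
have lt' j : (j < k)%N -> (nth 0%N xs j < 2 ^ tpar L k p j.+1)%N.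
  by move=> jk; rewrite -nbs // lt // bsk.
pose ok := if combine_results L k p (outcome L k p xs) is Some m
  then good_output L p r m else false.
apply: (@le_trans _ _ (if ok then r%:R^-1 * \sum_(s < r) \prod_(j < k)
    sqnorm (psi (tpar L k p j.+1) (omega_par L k r j.+1 s) (nth 0%N xs j)) else 0)); last first.
  rewrite /ok -(phi_final_prob _ _ _ _ _ _ _ NL a0 N0 co ord).
  case: (combine_results _ _ _ _) => [m|]; last by rewrite sumr_ge0.
  by case: good_output => //; rewrite sumr_ge0.
rewrite bsk; case: ifP => okE.
  rewrite ler_pM2l ?invr_gt0 ?ltr0n //; apply: ler_sum => s _.
  apply: ler_prod => j _; rewrite /f; case: ifP; rewrite ?sqnorm_ge0 ?lexx //.
(* Without a good output, some register is not close for this [s], and its factor vanishes. *)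
rewrite big1 ?mulr0 // => s _.
case: (boolP [forall j : 'I_k, close (2 ^ tpar L k p j.+1) (2 ^ p - 1)
     (reg_floor L k p r s j.+1) (nth 0%N xs j)]) => [/forallP h|].
  have [|m mE mg] := combine_results_good L k p r s xs L0 k0 kL r0 rL (ltn_ord s) lt'.
    by move=> j jk; exact: (h (Ordinal jk)).
  by rewrite /ok mE mg in okE.
rewrite negb_forall => /existsP[j hj].
by rewrite (bigD1 j) //= /f (negPf hj) mul0r.
Qed.
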